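(* Let $\otimes_\alpha$ be a tensor product of order $2$ of $0$-symmetric convex bodies. For every pair of finite dimensional real normed spaces $M,N$ and every linear map $T:M\to N$ define $$A(T:M\to N):=\|u_T\|_{\otimes_\alpha},$$ where $u_T\in M^*\otimes N$ is the tensor corresponding to $T$ and $\|\cdot\|_{\otimes_\alpha}$ is the tensor norm on $M^*\otimes N$ induced by $\otimes_\alpha$. Then $A$ is an ideal norm.
   Context: A Euclidean space is a finite dimensional real inner product space; $\mathbb{E}_i,\mathbb{F}_i$ denote Euclidean spaces. $\mathbb{E}_1\otimes\mathbb{E}_2$ carries the scalar product determined by $\langle x^1\otimes x^2,y^1\otimes y^2\rangle_H=\langle x^1,y^1\rangle\langle x^2,y^2\rangle$. A convex body is a compact convex set with nonempty interior; it is $0$-symmetric if $P=-P$. The polar of $C$ is $C^\circ=\{y:\sup_{x\in C}\langle x,y\rangle\le1\}$ (with respect to $\langle\cdot,\cdot\rangle_H$ in tensor product spaces). $g_P(x)=\inf\{\lambda>0:\lambda^{-1}x\in P\}$. For convex bodies $P_i\subset\mathbb{E}_i$ with $0$ in the interior, $P_1\otimes_\pi P_2:=\mathrm{conv}\{x^1\otimes x^2:x^i\in P_i\}$ and $P_1\otimes_\epsilon P_2:=(P_1^\circ\otimes_\pi P_2^\circ)^\circ$. A tensor product $\otimes_\alpha$ of order $2$ of $0$-symmetric convex bodies assigns to each pair of $0$-symmetric convex bodies $P_i\subset\mathbb{E}_i$ a $0$-symmetric convex body $P_1\otimes_\alpha P_2\subset\mathbb{E}_1\otimes\mathbb{E}_2$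 such that (1) $P_1\otimes_\pi P_2\subseteq P_1\otimes_\alpha P_2\subseteq P_1\otimes_\epsilon P_2$; (2) for all linear $T_i:\mathbb{E}_i\to\mathbb{F}_i$ and $0$-symmetric convex bodies $Q_i\subset\mathbb{F}_i$ with $T_i(P_i)\subseteq Q_i$, $T_1\otimes T_2(P_1\otimes_\alpha P_2)\subseteq Q_1\otimes_\alpha Q_2$. For finite dimensional normed spaces $M_1,M_2$ with closed unit balls $B_1,B_2$, $\|z\|_{\otimes_\alpha}:=g_{B_1\otimes_\alpha B_2}(z)$ for $z\in M_1\otimes M_2$, where $B_1\otimes_\alpha B_2$ is formed after fixing any scalar product on each $M_i$ (the result does not depend on the choice). For a linear map $T=\sum_{i=1}^n x_i^*(\cdot)y_i:M\to N$ between finite dimensional normed spaces, $u_T:=\sum_{i=1}^n x_i^*\otimes y_i\in M^*\otimes N$. An ideal norm $A$ (a Banach operator ideal restricted to finite dimensional normed spaces) assigns to each pair $M,N$ of finite dimensional normed spaces a norm $A$ on $\mathcal{L}(M,N)$ such that $A(\varphi(\cdot)y)=\|\varphi\|\|y\|$ for all $\varphi\in M^*$, $y\in N$, and $A(RST)\le\|R\|A(S)\|T\|$ for all $S\in\mathcal{L}(M_0,N_0)$, $T\in\mathcal{L}(M,M_0)$, $R\in\mathcal{L}(N_0,N)$. *)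

(* Defs.v *)
From HB Require Import structures.
From mathcomp Require Import all_boot all_order all_algebra.
From mathcomp Require Import ring lra.
From mathcomp Require Import all_classical all_reals all_analysis.

Set Implicit Arguments.
Unset Strict Implicit.
Unset Printing Implicit Defensive.

Import Order.TTheory GRing.Theory Num.Theory.
Import numFieldNormedType.Exports.

Local Open Scope classical_set_scope.
Local Open Scope ring_scope.

#[short(type="normedVectType")]
HB.structure Definition NormedVector (R : numDomainType) :=
  {V of NormedModule R V & Vector R V}.
HB.instance Definition _ (R : realType) := Vector.on R^o.

Record euclid (R : realType) := Euclid {
  euclid_sort :> vectType R;
  euclid_dot : {dot euclid_sort for idfun} }.

Definition dot (R : realType) (E : euclid R) (x y : E) : R :=
  euclid_dot E x y.
Arguments dot {R} E x y.

Definition euclid_norm (R : realType) (E : euclid R) (x : E) : R :=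
  Num.sqrt (dot E x x).
Arguments euclid_norm {R} E x.

Section euclid_norm.
Variables (R : realType) (E : euclid R).
Implicit Types x y : E.

Lemma dotC x y : dot E x y = dot E y x.
Proof. by rewrite /dot (@hermitian_subproof _ _ _ _ (euclid_dot E)) expr0 mul1r. Qed.

Lemma dotDl x y z : dot E (x + y) z = dot E x z + dot E y z.
Proof. exact: linearDl. Qed.

Lemma dotZl (a : R) x z : dot E (a *: x) z = a * dot E x z.
Proof. exact: (@linearl_subproof _ _ _ _ _ _ (euclid_dot E)). Qed.

Lemma dotDr x y z : dot E z (x + y) = dot E z x + dot E z y.
Proof. by rewrite !(dotC z) dotDl. Qed.

Lemma dotZr (a : R) x z : dot E z (a *: x) = a * dot E z x.
Proof. by rewrite !(dotC z) dotZl. Qed.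

Lemma dot_gt0 x : x != 0 -> 0 < dot E x x.
Proof. exact: neq0_dnorm_gt0. Qed.

Lemma dot0l z : dot E 0 z = 0.
Proof. by rewrite -(scale0r z) dotZl mul0r. Qed.

Lemma dot_ge0 x : 0 <= dot E x x.
Proof.
have [->|/dot_gt0/ltW//] := eqVneq x 0.
by rewrite dot0l.
Qed.

Lemma cauchy_schwarz x y : dot E x y ^+ 2 <= dot E x x * dot E y y.
Proof.
have [->|y0] := eqVneq y 0; first by rewrite dotC !dot0l expr0n mulr0.
have := dot_ge0 (dot E y y *: x - dot E x y *: y).
rewrite -scaleNr dotDl !dotDr !dotZl !dotZr (dotC y x) => h.
rewrite -subr_ge0 -(pmulr_rge0 _ (dot_gt0 y0)).
by congr (0 <= _): h; ring.
Qed.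

Lemma euclid_normD x y :
  euclid_norm E (x + y) <= euclid_norm E x + euclid_norm E y.
Proof.
rewrite -(@ler_pXn2r _ 2)// ?nnegrE ?addr_ge0 ?sqrtr_ge0//.
rewrite sqrrD !sqr_sqrtr ?dot_ge0// dotDl !dotDr (dotC y x).
suff : dot E x y <= euclid_norm E x * euclid_norm E y by rewrite /euclid_norm; lra.
rewrite /euclid_norm -sqrtrM ?dot_ge0//; apply: le_trans (ler_norm _) _.
by rewrite -sqrtr_sqr ler_sqrt ?sqr_ge0 ?mulr_ge0 ?dot_ge0// cauchy_schwarz.
Qed.

Lemma euclid_normZ (a : R) x : euclid_norm E (a *: x) = `|a| * euclid_norm E x.
Proof.
by rewrite /euclid_norm dotZl dotZr mulrA -expr2 sqrtrM ?sqr_ge0// sqrtr_sqr.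
Qed.

Lemma euclid_norm0_eq0 x : euclid_norm E x = 0 -> x = 0.
Proof.
move=> /eqP; rewrite sqrtr_eq0 => h; apply/eqP; apply: contraTT h => /dot_gt0.
by rewrite -ltNge.
Qed.

End euclid_norm.

(* The same vector space, carrying the topology of the Euclidean norm: the scalar
   product is data attached to a vectType, which by itself has no topology. *)
Definition euclid_space (R : realType) (E : euclid R) : Type := E.
HB.instance Definition _ (R : realType) (E : euclid R) :=
  Vector.copy (euclid_space E) E.
HB.instance Definition _ (R : realType) (E : euclid R) :=
  @Lmodule_isNormed.Build R (euclid_space E) (@euclid_norm R E)
    (@euclid_normD R E) (@euclid_normZ R E) (@euclid_norm0_eq0 R E).

Definition convex_body (R : realType) (E : euclid R) (P : set E) : Prop :=
  [/\ compact (P : set (euclid_space E)),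
      convex_set (P : set (convex_lmodType E)) &
      (P : set (euclid_space E))° !=set0].
Arguments convex_body {R} E P.

Definition sym_convex_body (R : realType) (E : euclid R) (P : set E) : Prop :=
  convex_body E P /\ [set - x | x in P] = P.
Arguments sym_convex_body {R} E P.

Definition polar (R : realType) (E : euclid R) (C : set E) : set E :=
  [set y | (ereal_sup [set (dot E x y)%:E | x in C] <= 1)%E].
Arguments polar {R} E C.

Definition gauge (R : realType) (V : lmodType R) (P : set V) (x : V) : R :=
  inf [set l : R | 0 < l /\ P (l^-1 *: x)].

(* The set of all convex combinations of points of S. *)
Definition conv_hull (R : realType) (V : lmodType R) (S : set V) : set V :=
  [set x | exists n (a : 'I_n -> R) (p : 'I_n -> V),
    [/\ forall i, 0 <= a i, \sum_i a i = 1, forall i, S (p i) &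
        x = \sum_i a i *: p i]].

Definition basis_vec (R : realType) (V : vectType R) (i : 'I_(\dim {:V})) : V :=
  (vbasis {:V})`_i.
Definition basis_coord (R : realType) (V : vectType R) (i : 'I_(\dim {:V}))
  (x : V) : R := coord (vbasis {:V}) i x.

(* V (x) W is modelled by coordinate matrices in the bases [vbasis {:V}] and
   [vbasis {:W}]: [pure] is bilinear (pureDl, pureDr), and the elementary tensors
   of basis vectors form a basis (tensorE).  The model does not depend on any
   scalar product on V and W. *)
Definition tensor (R : realType) (V W : vectType R) : Type :=
  'M[R]_(\dim {:V}, \dim {:W}).
HB.instance Definition _ (R : realType) (V W : vectType R) :=
  Vector.copy (tensor V W) 'M[R]_(\dim {:V}, \dim {:W}).

Definition pure (R : realType) (V W : vectType R) (x : V) (y : W) : tensor V W :=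
  \matrix_(i, j) (basis_coord i x * basis_coord j y).

(* The linear map S (x) T, see tensor_map_linear and tensor_map_pure. *)
Definition tensor_map (R : realType) (V V' W W' : vectType R)
    (S : 'Hom(V, V')) (T : 'Hom(W, W')) (z : tensor V W) : tensor V' W' :=
  \sum_i \sum_j z i j *: pure (S (basis_vec i)) (T (basis_vec j)).

(* The scalar product determined by <x (x) y, x' (x) y'> = <x, x'> <y, y'>, see
   tensor_dot_pure. *)
Definition tensor_dot (R : realType) (E1 E2 : euclid R) (z w : tensor E1 E2) : R :=
  \sum_i \sum_j \sum_k \sum_l z i j * w k l *
    (dot E1 (basis_vec i) (basis_vec k) * dot E2 (basis_vec j) (basis_vec l)).

Section tensor_theory.
Variables (R : realType).
Implicit Types V W : vectType R.

Lemma basis_coordE V (x : V) : x = \sum_i basis_coord i x *: basis_vec i.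
Proof. exact: (coord_vbasis (memvf x)). Qed.

Lemma basis_coord_linear V (i : 'I_(\dim {:V})) : scalar (basis_coord i).
Proof. by move=> a x y; rewrite /basis_coord linearP. Qed.

Lemma basis_coord_vec V (i j : 'I_(\dim {:V})) :
  basis_coord i (basis_vec j) = (j == i)%:R.
Proof. by rewrite /basis_coord coord_free// (basis_free (vbasisP _)). Qed.

Lemma pureDl V W (a : R) (x x' : V) (y : W) :
  pure (a *: x + x') y = a *: pure x y + pure x' y.
Proof. by apply/matrixP => i j; rewrite !mxE basis_coord_linear mulrDl mulrA. Qed.

Lemma pureDr V W (a : R) (x : V) (y y' : W) :
  pure x (a *: y + y') = a *: pure x y + pure x y'.
Proof. by apply/matrixP => i j; rewrite !mxE basis_coord_linear mulrDr mulrCA. Qed.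

Lemma tensorE V W (z : tensor V W) :
  z = \sum_i \sum_j z i j *: pure (basis_vec i) (basis_vec j).
Proof.
apply/matrixP => i j; rewrite summxE (bigD1 i)//= summxE (bigD1 j)//=.
rewrite !mxE !basis_coord_vec !eqxx mulr1 mulr1 big1 ?addr0 => [|k kj]; last first.
  by rewrite !mxE !basis_coord_vec (negbTE kj) !mulr0.
rewrite big1 ?addr0// => k ki; rewrite summxE big1// => l _.
by rewrite !mxE !basis_coord_vec (negbTE ki) mul0r mulr0.
Qed.

Lemma tensor_map_linear V V' W W' (S : 'Hom(V, V')) (T : 'Hom(W, W')) :
  linear (tensor_map S T).
Proof.
move=> a z w; rewrite /tensor_map scaler_sumr -big_split; apply: eq_bigr => i _.
rewrite /= scaler_sumr -big_split; apply: eq_bigr => j _ /=.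
by rewrite !mxE scalerA scalerDl.
Qed.

Lemma pure_suml V W I (r : seq I) (a : I -> R) (x : I -> V) (y : W) :
  pure (\sum_(i <- r) a i *: x i) y = \sum_(i <- r) a i *: pure (x i) y.
Proof.
elim: r => [|i r ih]; last by rewrite !big_cons pureDl ih.
by rewrite !big_nil -[X in pure X _](addNr 0) -scaleN1r pureDl scaleN1r addNr.
Qed.

Lemma pure_sumr V W I (r : seq I) (a : I -> R) (x : V) (y : I -> W) :
  pure x (\sum_(i <- r) a i *: y i) = \sum_(i <- r) a i *: pure x (y i).
Proof.
elim: r => [|i r ih]; last by rewrite !big_cons pureDr ih.
by rewrite !big_nil -[X in pure _ X](addNr 0) -scaleN1r pureDr scaleN1r addNr.
Qed.

Lemma tensor_map_pure V V' W W' (S : 'Hom(V, V')) (T : 'Hom(W, W'))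
    (x : V) (y : W) :
  tensor_map S T (pure x y) = pure (S x) (T y).
Proof.
rewrite [in RHS](basis_coordE x) [in RHS](basis_coordE y) !linear_sum.
under [in RHS]eq_bigr do rewrite linearZ.
rewrite pure_suml; apply: eq_bigr => i _.
under [in RHS]eq_bigr do rewrite linearZ.
rewrite pure_sumr scaler_sumr; apply: eq_bigr => j _.
by rewrite !mxE scalerA.
Qed.

End tensor_theory.

Section tensor_dot_theory.
Variable R : realType.

Lemma cholesky n (G : 'M[R]_n) : G^T = G ->
  (forall u : 'rV[R]_n, u != 0 -> 0 < (u *m G *m u^T) 0 0) ->
  exists L : 'M[R]_n, G = L *m L^T.
Proof.
elim: n G => [|n ih] G Gs Gp; first by exists 0; rewrite [LHS]flatmx0 [RHS]flatmx0.
pose G' : 'M[R]_(1 + n) := G.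
pose a := G' 0 0; pose b := ursubmx G'; pose C := drsubmx G'.
have Gp' (u : 'rV[R]_(1 + n)) : u != 0 -> 0 < (u *m G' *m u^T) 0 0 by exact: Gp.
have GE : G' = block_mx a%:M b b^T C.
  rewrite -[LHS]submxK; congr block_mx.
    by apply/matrixP => i j; rewrite !ord1 !mxE eqxx mulr1n; congr (G _ _); exact/val_inj.
  by rewrite /b trmx_ursub (_ : G'^T = G').
have Cs : C^T = C by rewrite /C trmx_drsub (_ : G'^T = G').
have a0 : 0 < a.
  have := Gp' (row_mx 1%:M 0 : 'rV[R]_(1 + n)); rewrite GE tr_row_mx mul_row_block mul_row_col.
  rewrite trmx1 trmx0 !mulmx0 !mul0mx !mul1mx mulmx1 !addr0 mxE eqxx mulr1n; apply.
  apply/eqP => /(congr1 lsubmx); rewrite row_mxKl linear0 => /matrixP/(_ 0 0).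
  by rewrite !mxE eqxx => /eqP; rewrite oner_eq0.
have [|v v0|L LE] := ih (C - a^-1 *: (b^T *m b)).
- by rewrite linearB linearZ/= trmx_mul trmxK Cs.
- have := Gp' (row_mx (- a^-1 *: (v *m b^T)) v : 'rV[R]_(1 + n)).
  rewrite GE tr_row_mx mul_row_block mul_row_col.
  set c := v *m b^T.
  have -> : (- a^-1 *: c) *m a%:M + v *m b^T = 0.
    by rewrite mul_mx_scalar scalerA mulrN mulfV ?gt_eqF// scaleN1r addNr.
  rewrite mul0mx add0r mulmxBr -scalemxAr -scalemxAl mulmxDl => h.
  rewrite mulmxBl -!scalemxAl !mulmxA.
  move: h; rewrite !scaleNr mulNmx -[in X in X -> _]scalemxAl -/c addrC; apply.
  apply: contraNneq v0 => /(congr1 rsubmx); rewrite row_mxKr linear0 => ->.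
  by [].
- pose s := Num.sqrt a.
  have ss : s * s = a by rewrite -expr2 sqr_sqrtr// ltW.
  have s0 : s != 0 by rewrite gt_eqF// sqrtr_gt0.
  pose L' : 'M[R]_(1 + n) := block_mx s%:M 0 (s^-1 *: b^T) L.
  suff LG : G' = L' *m L'^T by exists L'; exact: LG.
  rewrite /L' GE tr_block_mx mulmx_block trmx0 !mulmx0 !mul0mx !addr0.
  rewrite tr_scalar_mx -scalar_mxM ss linearZ/= trmxK.
  rewrite mul_scalar_mx mul_mx_scalar !scalerA mulfV// !scale1r.
  rewrite -scalemxAl -scalemxAr scalerA -LE -invfM ss.
  by rewrite addrC subrK.
Qed.

Variables E1 E2 : euclid R.
Implicit Types z w : tensor E1 E2.

Lemma tensor_dotE z w : tensor_dot z w = \sum_p \sum_q z p.1 p.2 * w q.1 q.2 *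
  (dot E1 (basis_vec p.1) (basis_vec q.1) * dot E2 (basis_vec p.2) (basis_vec q.2)).
Proof.
rewrite /tensor_dot pair_big; apply: eq_bigr => -[i j] _ /=.
by rewrite pair_big; apply: eq_bigr => -[].
Qed.

Lemma tensor_dotC z w : tensor_dot z w = (-1) ^+ false * idfun (tensor_dot w z).
Proof.
rewrite expr0 mul1r /= !tensor_dotE exchange_big; apply: eq_bigr => p _.
apply: eq_bigr => q _.
by rewrite [dot E1 _ _]dotC [dot E2 _ _]dotC [z _ _ * _]mulrC.
Qed.

Lemma tensor_dotP w : scalar (fun z => tensor_dot z w).
Proof.
move=> a x y; rewrite /tensor_dot /=.
rewrite mulr_sumr -big_split; apply: eq_bigr => i _ /=.
rewrite mulr_sumr -big_split; apply: eq_bigr => j _ /=.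
rewrite mulr_sumr -big_split; apply: eq_bigr => k _ /=.
rewrite mulr_sumr -big_split; apply: eq_bigr => l _ /=.
by rewrite !mxE; ring.
Qed.

Lemma tensor_dotPr w : scalar (fun z => tensor_dot w z).
Proof.
by move=> a x y; rewrite ![tensor_dot w _]tensor_dotC /= !expr0 !mul1r tensor_dotP.
Qed.

Lemma dot_suml (E : euclid R) I (r : seq I) (a : I -> R) (x : I -> E) (y : E) :
  dot E (\sum_(i <- r) a i *: x i) y = \sum_(i <- r) a i * dot E (x i) y.
Proof.
elim: r => [|i r ih]; first by rewrite !big_nil dot0l.
by rewrite !big_cons dotDl dotZl ih.
Qed.

Lemma tensor_dot_pure (x x' : E1) (y y' : E2) :
  tensor_dot (pure x y) (pure x' y') = dot E1 x x' * dot E2 y y'.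
Proof.
have E (V : euclid R) (u v : V) : dot V u v = \sum_i \sum_k
    basis_coord i u * (basis_coord k v * dot V (basis_vec i) (basis_vec k)).
  rewrite {1}(basis_coordE u) dot_suml; apply: eq_bigr => i _.
  rewrite {1}(basis_coordE v) dotC dot_suml mulr_sumr; apply: eq_bigr => k _.
  by rewrite [dot _ (basis_vec k) _]dotC.
rewrite (E _ x) (E _ y) /tensor_dot big_distrlr /=; apply: eq_bigr => i _.
apply: eq_bigr => j _; rewrite big_distrlr /=; apply: eq_bigr => k _.
by apply: eq_bigr => l _; rewrite !mxE; ring.
Qed.

Lemma tensor_dot_gt0 z : z != 0 -> 0 < tensor_dot z z.
Proof.
move=> z0.
pose G2 : 'M[R]_(\dim {:E2}) := \matrix_(j, l) dot E2 (basis_vec j) (basis_vec l).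
have basis_inj (V : vectType R) (a : 'I_(\dim {:V}) -> R) :
    \sum_j a j *: basis_vec j = 0 -> forall j, a j = 0.
  move=> h j; rewrite -(coord_sum_free a j (basis_free (vbasisP {:V}))).
  by rewrite [X in coord _ _ X]h linear0.
have [||L GL] := @cholesky _ G2.
- by apply/matrixP => i j; rewrite !mxE dotC.
- move=> u u0.
  have -> : (u *m G2 *m u^T) 0 0 =
      dot E2 (\sum_j u 0 j *: basis_vec j) (\sum_j u 0 j *: basis_vec j).
    rewrite dot_suml mxE; under eq_bigr do rewrite !mxE mulr_suml.
    rewrite exchange_big; apply: eq_bigr => i _ /=.
    rewrite dotC dot_suml mulr_sumr; apply: eq_bigr => j _.
    by rewrite !mxE [dot _ (basis_vec i) _]dotC; ring.
  apply: dot_gt0; apply: contraNneq u0 => /basis_inj h.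
  by apply/eqP/rowP => j; rewrite h mxE.
pose zL : 'M[R]_(\dim {:E1}, \dim {:E2}) := (z : 'M[R]_(_, _)) *m L.
pose c k := \sum_i zL i k *: basis_vec i : E1.
have zE : tensor_dot z z = \sum_k dot E1 (c k) (c k).
  have G2E j l : dot E2 (basis_vec j) (basis_vec l) = \sum_k L j k * L l k.
    transitivity (G2 j l); first by rewrite mxE.
    by rewrite GL mxE; apply: eq_bigr => k _; rewrite mxE.
  transitivity (\sum_k \sum_i \sum_i' zL i k * (zL i' k * dot E1 (basis_vec i) (basis_vec i'))).
    rewrite exchange_big; apply: eq_bigr => i _ /=.
    rewrite exchange_big [RHS]exchange_big; apply: eq_bigr => i' _ /=.
    rewrite (eq_bigr (fun j => \sum_l \sum_k z i j * z i' l *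
       (dot E1 (basis_vec i) (basis_vec i') * (L j k * L l k)))); last first.
      by move=> j _; apply: eq_bigr => l _; rewrite G2E !mulr_sumr.
    under eq_bigr do rewrite exchange_big.
    rewrite exchange_big; apply: eq_bigr => k _ /=.
    rewrite /zL !mxE mulrA big_distrlr /= mulr_suml; apply: eq_bigr => j _.
    by rewrite mulr_suml; apply: eq_bigr => l _; ring.
  apply: eq_bigr => k _; rewrite /c dot_suml; apply: eq_bigr => i _.
  rewrite dotC dot_suml mulr_sumr; apply: eq_bigr => i' _.
  by rewrite [dot _ (basis_vec i') _]dotC.
rewrite zE lt_def sumr_ge0 ?andbT => [|k _]; last exact: dot_ge0.
apply: contraNneq z0 => /eqP; rewrite psumr_eq0 => [/allP h|k _]; last exact: dot_ge0.
have zL0 : zL = 0.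
  apply/matrixP => i k; rewrite [RHS]mxE.
  have /eqP ck : dot E1 (c k) (c k) == 0 by apply: h; rewrite mem_index_enum.
  have := basis_inj E1 (fun i => zL i k); apply; rewrite -[LHS]/(c k).
  by apply/eqP; apply: contra_eqT ck => /dot_gt0; rewrite lt0r => /andP[].
apply/eqP/row_matrixP => i; rewrite row0; apply/eqP.
pose u : 'rV[R]_(\dim {:E2}) := row i (z : 'M[R]_(_, _)).
have uG : u *m G2 = 0.
  by rewrite GL mulmxA -row_mul (_ : _ *m L = zL)// zL0 row0 mul0mx.
have : dot E2 (\sum_j u 0 j *: basis_vec j) (\sum_j u 0 j *: basis_vec j) = 0.
  rewrite dot_suml big1// => l _.
  have ul : (u *m G2) 0 l = 0 by rewrite uG mxE.
  rewrite dotC dot_suml -[RHS](mulr0 (u 0 l)) -[in RHS]ul; congr (_ * _); rewrite [RHS]mxE.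
  by apply: eq_bigr => j _; rewrite [G2 _ _]mxE.
move=> /eqP; apply: contraTT => u0; rewrite gt_eqF//; apply: dot_gt0.
apply: contraNneq u0 => /basis_inj h0.
by apply/eqP/rowP => j; rewrite -/u h0 mxE.
Qed.

HB.instance Definition _ := isBilinear.Build R (tensor E1 E2) (tensor E1 E2) R
  ( *%R ) (idfun \; *%R) (@tensor_dot R E1 E2)
  (fun w => zmod_morphism_linear (tensor_dotP w))
  (fun w => zmod_morphism_linear (tensor_dotPr w))
  (fun w => scalable_linear (tensor_dotP w))
  (fun w => scalable_linear (tensor_dotPr w)).
HB.instance Definition _ := isHermitianSesquilinear.Build R (tensor E1 E2)
  false idfun (@tensor_dot R E1 E2) tensor_dotC.
HB.instance Definition _ := isDotProduct.Build R (tensor E1 E2)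
  (@tensor_dot R E1 E2) tensor_dot_gt0.

End tensor_dot_theory.

Definition tensor_euclid (R : realType) (E1 E2 : euclid R) : euclid R :=
  @Euclid R (tensor E1 E2) (@tensor_dot R E1 E2).

Lemma basis_coord_bounded (R : realType) (M : normedVectType R)
    (i : 'I_(\dim {:M})) :
  exists2 C, 0 <= C & forall x : M, `|basis_coord i x| <= C * `|x|.
Proof.
set n := \dim {:M} in i *.
pose G (a : 'rV[R]_n) : M := \sum_j a 0 j *: basis_vec j.
have Gcont : continuous G.
  apply: (@continuous_big M _ +%R 0 xpredT (@add_continuous M) _ _
    (fun j (b : 'rV[R]_n) => b 0 j *: basis_vec j)) => j _ a.
  apply: (@continuous_comp _ _ _ (fun b : 'rV[R]_n => b 0 j) (fun k : R => k *: (basis_vec j : M))).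
    exact: coord_continuous.
  exact: scalel_continuous.
have Fc : continuous (Num.norm \o G).
  by move=> a; apply: continuous_comp; [exact: Gcont|exact: norm_continuous].
pose S := [set a : 'rV[R]_n | `|a| = 1].
have Sc : compact S.
  apply: bounded_closed_compact.
    by exists 1; split => // r r1 a; rewrite /S /= => ->; exact: ltW.
  rewrite (_ : S = Num.norm @^-1` [set x | x = 1])//; apply: preimage_closed.
    by move=> a _; exact: norm_continuous.
  exact: closed_eq.
have norm_le (a : 'rV[R]_n) : `|a 0 i| <= `|a|.
  rewrite [leRHS]/Num.norm /= mx_normrE.
  exact: (le_bigmax _ (fun p : 'I_1 * 'I_n => `|a p.1 p.2|) (0, i)).
have S1 (a : 'rV[R]_n) : a != 0 -> S (`|a|^-1 *: a).
  by move=> a0; rewrite /S /= normrZ normfV normr_id mulVf// normr_eq0.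
have S0 : S !=set0.
  pose d : 'rV[R]_n := delta_mx 0 i; exists (`|d|^-1 *: d); apply: S1.
  apply/eqP => /matrixP/(_ 0 i); rewrite !mxE !eqxx.
  by move/eqP; rewrite oner_eq0.
have [c /set_mem Sc1 cmin] := compact_EVT_min S0 Sc (continuous_subspaceT Fc).
have Fc0 : 0 < `|G c|.
  rewrite normr_gt0; apply/eqP => Gc; move: Sc1; rewrite /S /= => /eqP.
  suff -> : c = 0 by rewrite normr0 eq_sym oner_eq0.
  apply/rowP => j; rewrite mxE.
  rewrite -[LHS](coord_sum_free (fun j => c 0 j) j (basis_free (vbasisP {:M}))).
  by rewrite [X in coord _ _ X]Gc linear0.
exists `|G c|^-1 => [|x]; first by rewrite invr_ge0.
rewrite mulrC ler_pdivlMr//.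
pose a : 'rV[R]_n := \row_j basis_coord j x.
have xa : x = G a.
  by rewrite {1}(basis_coordE x); apply: eq_bigr => j _; rewrite mxE.
have -> : basis_coord i x = a 0 i by rewrite mxE.
have [->|a0] := eqVneq a 0; first by rewrite mxE normr0 mul0r.
have := cmin _ (mem_set (S1 _ a0)); rewrite /= => cm.
have Ga : `|G (`|a|^-1 *: a)| = `|a|^-1 * `|x|.
  rewrite (_ : G _ = `|a|^-1 *: G a); last first.
    by rewrite scaler_sumr; apply: eq_bigr => j _; rewrite mxE scalerA.
  by rewrite -xa normrZ normfV normr_id.
have a1 : 0 < `|a| by rewrite normr_gt0.
move: cm; rewrite Ga mulrC ler_pdivlMr// => cm.
by apply: le_trans cm; rewrite mulrC ler_wpM2l// ltW.
Qed.

Lemma lfun_bounded (R : realType) (M N : normedVectType R) (f : 'Hom(M, N)) :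
  exists2 C, 0 <= C & forall x, `|f x| <= C * `|x|.
Proof.
have /choice[C hC] : forall i : 'I_(\dim {:M}), exists C,
    0 <= C /\ forall x : M, `|basis_coord i x| <= C * `|x|.
  by move=> i; have [C C0 h] := basis_coord_bounded i; exists C.
exists (\sum_i C i * `|f (basis_vec i)|) => [|x].
  by apply: sumr_ge0 => i _; rewrite mulr_ge0//; case: (hC i).
rewrite {1}(basis_coordE x) linear_sum mulr_suml.
apply: le_trans (ler_norm_sum _ _ _) _; apply: ler_sum => i _.
by rewrite linearZ normrZ mulrAC ler_wpM2r//; case: (hC i).
Qed.

Definition opnorm (R : realType) (M N : normedVectType R) (f : 'Hom(M, N)) : R :=
  sup [set `|f x| | x in [set x : M | `|x| <= 1]].

Section opnorm_theory.
Variables (R : realType) (M N : normedVectType R).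
Implicit Types f g : 'Hom(M, N).

Lemma opnorm_has_sup f : has_sup [set `|f x| | x in [set x : M | `|x| <= 1]].
Proof.
split; first by exists `|f 0|, 0 => //=; rewrite normr0.
have [C C0 fC] := lfun_bounded f; exists C => _ [x /= x1 <-].
by apply: le_trans (fC x) _; rewrite ler_piMr.
Qed.

Lemma opnorm_ge f x : `|x| <= 1 -> `|f x| <= opnorm f.
Proof. by move=> x1; apply: ub_le_sup; [case: (opnorm_has_sup f)|exists x]. Qed.

Lemma opnorm_le f (C : R) :
  (forall x, `|x| <= 1 -> `|f x| <= C) -> opnorm f <= C.
Proof.
move=> h; apply: ge_sup => [|_ [x x1 <-]]; last exact: h.
by case: (opnorm_has_sup f).
Qed.

Lemma opnorm_ge0 f : 0 <= opnorm f.
Proof. by apply: le_trans (@opnorm_ge f 0 _); rewrite ?normr0. Qed.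

Lemma le_opnorm f x : `|f x| <= opnorm f * `|x|.
Proof.
have [->|x0] := eqVneq x 0; first by rewrite linear0 !normr0 mulr0.
have n0 : 0 < `|x| by rewrite normr_gt0.
rewrite -ler_pdivrMr// mulrC -[X in X * _]ger0_norm ?invr_ge0// -normrZ -linearZ.
by apply: opnorm_ge; rewrite normrZ normfV normr_id mulVf// gt_eqF.
Qed.

Lemma opnormD f g : opnorm (f + g) <= opnorm f + opnorm g.
Proof.
apply: opnorm_le => x x1; rewrite add_lfunE.
by apply: le_trans (ler_normD _ _) _; apply: lerD; exact: opnorm_ge.
Qed.

Lemma opnormZ (a : R) f : opnorm (a *: f) = `|a| * opnorm f.
Proof.
have h (b : R) (g : 'Hom(M, N)) : opnorm (b *: g) <= `|b| * opnorm g.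
  apply: opnorm_le => x x1; rewrite scale_lfunE normrZ ler_wpM2l//.
  exact: opnorm_ge.
apply/eqP; rewrite eq_le h /=.
have [->|a0] := eqVneq a 0; first by rewrite normr0 mul0r opnorm_ge0.
rewrite -ler_pdivlMl ?normr_gt0// -normfV.
by rewrite -{1}[f](scalerK a0) h.
Qed.

Lemma opnorm0_eq0 f : opnorm f = 0 -> f = 0.
Proof.
move=> f0; apply/lfunP => x; rewrite zero_lfunE; apply/eqP.
by rewrite -normr_le0 (le_trans (le_opnorm f x))// f0 mul0r.
Qed.

End opnorm_theory.

(* M^* with the dual norm; an alias of 'Hom(M, R^o), which has no norm in the
   library. *)
Definition dual (R : realType) (M : normedVectType R) : Type := 'Hom(M, R^o).
HB.instance Definition _ (R : realType) (M : normedVectType R) :=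
  Vector.copy (dual M) 'Hom(M, R^o).
HB.instance Definition _ (R : realType) (M : normedVectType R) :=
  @Lmodule_isNormed.Build R (dual M) (@opnorm R M R^o)
    (@opnormD R M R^o) (@opnormZ R M R^o) (@opnorm0_eq0 R M R^o).
Definition dual_fun (R : realType) (M : normedVectType R) (f : dual M) :
  'Hom(M, R^o) := f.
Coercion dual_fun : dual >-> hom.

(* The map f(.) y. *)
Definition rank_one (R : realType) (M N : normedVectType R)
  (f : dual M) (y : N) : 'Hom(M, N) := linfun (fun x => (f x : R) *: y).

(* u_T, computed from T = \sum_i e_i^*(.) T(e_i) (lfun_rank_one); any other
   representation of T gives the same tensor (lfun_tensor_rank_one). *)
Definition lfun_tensor (R : realType) (M N : normedVectType R) (T : 'Hom(M, N)) :
    tensor (dual M) N :=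
  \sum_i pure (linfun (basis_coord i : M -> R^o) : dual M) (T (basis_vec i)).

Section lfun_tensor_theory.
Variables (R : realType) (M N : normedVectType R).

Lemma rank_oneE (f : dual M) (y : N) x : rank_one f y x = (f x : R) *: y.
Proof.
have h : linear (fun x : M => (f x : R) *: y).
  by move=> a u v; rewrite linearP scalerDl scalerA.
pose F : {linear M -> N} := HB.pack (fun x : M => (f x : R) *: y)
  (GRing.isLinear.Build _ _ _ _ _ h).
exact: (lfunE F).
Qed.

Lemma linfun_coordE (i : 'I_(\dim {:M})) x :
  (linfun (basis_coord i : M -> R^o) : 'Hom(M, R^o)) x = basis_coord i x.
Proof.
pose F : {linear M -> R^o} := HB.pack (basis_coord i : M -> R^o)
  (GRing.isLinear.Build R M R^o *:%R (basis_coord i : M -> R^o)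
    (@basis_coord_linear R M i)).
exact: (lfunE F).
Qed.

Lemma lfun_rank_one (T : 'Hom(M, N)) :
  T = \sum_i rank_one (linfun (basis_coord i : M -> R^o) : dual M)
                      (T (basis_vec i)).
Proof.
apply/lfunP => x; rewrite sum_lfunE {1}(basis_coordE x) linear_sum.
by apply: eq_bigr => i _; rewrite linearZ rank_oneE /= linfun_coordE.
Qed.

Lemma lfun_tensor_rank_one n (f : 'I_n -> dual M) (y : 'I_n -> N) :
  lfun_tensor (\sum_(k < n) rank_one (f k) (y k)) = \sum_(k < n) pure (f k) (y k).
Proof.
rewrite /lfun_tensor.
transitivity (\sum_i \sum_k (f k (basis_vec i) : R) *:
    pure (linfun (basis_coord i : M -> R^o) : dual M) (y k)).
  apply: eq_bigr => i _; rewrite -pure_sumr sum_lfunE; congr pure.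
  by apply: eq_bigr => k _; rewrite rank_oneE.
rewrite exchange_big; apply: eq_bigr => k _ /=.
rewrite -pure_suml; congr pure; apply/lfunP => x; rewrite sum_lfunE.
rewrite [in RHS](basis_coordE x) linear_sum; apply: eq_bigr => i _.
by rewrite scale_lfunE linfun_coordE linearZ; exact: mulrC.
Qed.

End lfun_tensor_theory.

Definition proj_tensor (R : realType) (E1 E2 : euclid R)
    (P1 : set E1) (P2 : set E2) : set (tensor_euclid E1 E2) :=
  conv_hull [set pure x1 x2 | x1 in P1 & x2 in P2].
Arguments proj_tensor {R} E1 E2 P1 P2.

Definition inj_tensor (R : realType) (E1 E2 : euclid R)
    (P1 : set E1) (P2 : set E2) : set (tensor_euclid E1 E2) :=
  polar (tensor_euclid E1 E2) (proj_tensor E1 E2 (polar E1 P1) (polar E2 P2)).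
Arguments inj_tensor {R} E1 E2 P1 P2.

(* An operation on pairs of 0-symmetric convex bodies; its values on other pairs
   of sets are unconstrained by is_tensor_product and never used. *)
Definition body_operation (R : realType) :=
  forall E1 E2 : euclid R, set E1 -> set E2 -> set (tensor_euclid E1 E2).

Record is_tensor_product (R : realType) (alpha : body_operation R) : Prop := {
  tensor_body : forall (E1 E2 : euclid R) (P1 : set E1) (P2 : set E2),
    sym_convex_body E1 P1 -> sym_convex_body E2 P2 ->
    sym_convex_body (tensor_euclid E1 E2) (alpha E1 E2 P1 P2);
  tensor_ge_proj : forall (E1 E2 : euclid R) (P1 : set E1) (P2 : set E2),
    sym_convex_body E1 P1 -> sym_convex_body E2 P2 ->
    proj_tensor E1 E2 P1 P2 `<=` alpha E1 E2 P1 P2;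
  tensor_le_inj : forall (E1 E2 : euclid R) (P1 : set E1) (P2 : set E2),
    sym_convex_body E1 P1 -> sym_convex_body E2 P2 ->
    alpha E1 E2 P1 P2 `<=` inj_tensor E1 E2 P1 P2;
  tensor_uniform : forall (E1 E2 F1 F2 : euclid R)
      (P1 : set E1) (P2 : set E2) (Q1 : set F1) (Q2 : set F2)
      (T1 : 'Hom(E1, F1)) (T2 : 'Hom(E2, F2)),
    sym_convex_body E1 P1 -> sym_convex_body E2 P2 ->
    sym_convex_body F1 Q1 -> sym_convex_body F2 Q2 ->
    T1 @` P1 `<=` Q1 -> T2 @` P2 `<=` Q2 ->
    tensor_map T1 T2 @` alpha E1 E2 P1 P2 `<=` alpha F1 F2 Q1 Q2 }.

Definition unit_ball (R : realType) (M : normedVectType R) : set M :=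
  [set x | `|x| <= 1].
Arguments unit_ball {R} M.

(* d1 and d2 are the scalar products fixed on M1 and M2. *)
Definition tensor_norm (R : realType) (alpha : body_operation R)
    (M1 M2 : normedVectType R)
    (d1 : {dot M1 for idfun}) (d2 : {dot M2 for idfun}) (z : tensor M1 M2) : R :=
  gauge (alpha (Euclid d1) (Euclid d2) (unit_ball M1) (unit_ball M2)) z.

Definition is_norm (R : realType) (V : lmodType R) (f : V -> R) : Prop :=
  [/\ forall x, f x = 0 -> x = 0,
      forall x y, f (x + y) <= f x + f y &
      forall (a : R) x, f (a *: x) = `|a| * f x].

Record is_ideal_norm (R : realType)
    (A : forall M N : normedVectType R, 'Hom(M, N) -> R) : Prop := {
  ideal_is_norm : forall M N, is_norm (A M N);
  ideal_rank_one : forall (M N : normedVectType R) (f : dual M) (y : N),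
    A M N (rank_one f y) = `|f| * `|y|;
  ideal_comp : forall (M M0 N0 N : normedVectType R)
      (T : 'Hom(M, M0)) (S : 'Hom(M0, N0)) (U : 'Hom(N0, N)),
    A M N (U \o S \o T)%VF <= opnorm U * A M0 N0 S * opnorm T }.

(* Main.v *)
From HB Require Import structures.
Require Import Defs.
From mathcomp Require Import all_boot all_order all_algebra.
From mathcomp Require Import ring lra.
From mathcomp Require Import all_classical all_reals all_analysis.

Import Order.TTheory GRing.Theory Num.Theory.
Import numFieldNormedType.Exports.

Set Implicit Arguments.
Unset Strict Implicit.
Unset Printing Implicit Defensive.

Local Open Scope classical_set_scope.
Local Open Scope ring_scope.

(** The ideal norm axioms translate into three properties of the tensor norm
    attached to alpha.

    - It is a norm: the gauge of a symmetric convex body is a norm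
      ([gauge_norm]), and T |-> u_T is linear and injective, because
      f (x) y |-> f(.) y extends to a linear left inverse ([lfun_tensorK]).
    - It is a cross norm ([tensor_norm_pure]): ||x (x) y|| = |x| |y|.  The
      inequality <= holds because alpha contains the projective product, which
      contains x/|x| (x) y/|y|.  The inequality >= holds because alpha lies in the
      injective product: pairing with u (x) v, for u and v in the polars of the
      two balls, bounds the norm below by <x, u> <y, v>, and these products come
      arbitrarily close to |x| |y| by separation ([lt_norm_polar]).
    - It has the mapping property ([tensor_norm_map]):
      ||(T1 (x) T2) z|| <= ||T1|| ||T2|| ||z||, which is the uniformity of alpha
      applied to the maps T1/||T1|| and T2/||T2||.  Since
      u_(U S T) = (T^* (x) U) u_S ([lfun_tensor_comp]) and ||T^*|| <= ||T||, this
      gives A(U S T) <= ||U|| A(S) ||T||.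

    The scalar products fixed on the spaces may be arbitrary and may differ from
    one pair of spaces to another: in finite dimension the unit ball is a
    symmetric convex body for every one of them ([unit_ball_body]), and uniformity
    compares bodies formed with different scalar products. *)

(** * Unit balls of finite-dimensional normed spaces *)

Lemma convex_setP (R : realType) (V : lmodType R) (A : set V) :
  convex_set (A : set (convex_lmodType V)) <->
  forall x y (t : R), A x -> A y -> 0 <= t -> t <= 1 ->
    A (t *: x + (1 - t) *: y).
Proof.
split=> [cA x y t Ax Ay t0 t1|cA x y l /set_mem Ax /set_mem Ay].
  exact: (set_mem (cA x y (Itv01 t0 t1) (mem_set Ax) (mem_set Ay))).
by apply/mem_set; apply: cA.
Qed.

Lemma lfun_continuous (R : realType) (M N : normedVectType R) (f : 'Hom(M, N)) :
  continuous f.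
Proof.
have [C C0 fC] := lfun_bounded f.
apply/linear_bounded_continuous/linear_boundedP.
exists C; split => [|r Cr x]; first exact: num_real.
by apply: le_trans (fC x) _; rewrite ler_wpM2r// ltW.
Qed.

(** Heine-Borel, transported from row vectors by the coordinate map: [G] sends a
    row of coordinates to the vector it represents and is continuous, and
    [basis_coord_bounded] makes the preimage of a bounded set bounded. *)
Lemma bounded_closed_compact_vect (R : realType) (M : normedVectType R)
    (A : set M) (C : R) :
  (forall x, A x -> `|x| <= C) -> closed A -> compact A.
Proof.
move=> AC clA; set n := \dim {:M}.
pose G (a : 'rV[R]_n) : M := \sum_j a 0 j *: basis_vec j.
have Gc : continuous G.
  apply: (@continuous_big M _ +%R 0 xpredT (@add_continuous M) _ _
    (fun j (b : 'rV[R]_n) => b 0 j *: basis_vec j)) => j _ a.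
  apply: (@continuous_comp _ _ _ (fun b : 'rV[R]_n => b 0 j)
    (fun k : R => k *: (basis_vec j : M))).
    exact: coord_continuous.
  exact: scalel_continuous.
have GK (x : M) : G (\row_j basis_coord j x) = x.
  by rewrite [RHS](basis_coordE x); apply: eq_bigr => j _; rewrite mxE.
have coordG (a : 'rV[R]_n) j : basis_coord j (G a) = a 0 j.
  exact: (coord_sum_free (fun j => a 0 j) j (basis_free (vbasisP {:M}))).
have -> : A = G @` (G @^-1` A).
  apply/seteqP; split => [x Ax|_ [a Aa <-]//].
  by exists (\row_j basis_coord j x); rewrite /= GK.
apply: continuous_compact; first exact: continuous_subspaceT.
apply: bounded_closed_compact; last first.
  by apply: preimage_closed => // a _; exact: Gc.
have /choice[D hD] : forall i : 'I_n, exists D,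
    0 <= D /\ forall x : M, `|basis_coord i x| <= D * `|x|.
  by move=> i; have [D D0 h] := basis_coord_bounded i; exists D.
have C0 (a : 'rV[R]_n) : A (G a) -> 0 <= C.
  by move=> /AC; exact: le_trans.
exists (\sum_i D i * C); split => [|r Cr a /= Aa]; first exact: num_real.
rewrite [leLHS]/Num.norm /= mx_normrE; apply/bigmax_leP; split => [|[i j] _ /=].
  apply: le_trans (ltW Cr); apply: sumr_ge0 => k _.
  by rewrite mulr_ge0 ?(C0 _ Aa)//; case: (hD k).
rewrite !ord1 -coordG; have [Dj0 hj] := hD j.
apply: le_trans (hj _) _; apply: le_trans (ltW Cr).
rewrite (bigD1 j)//= -[leLHS]addr0 lerD//; first by rewrite ler_wpM2l ?AC.
by apply: sumr_ge0 => k _; rewrite mulr_ge0 ?(C0 _ Aa)//; case: (hD k).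
Qed.

Section unit_ball_body.
Variables (R : realType) (M : normedVectType R) (d : {dot M for idfun}).
Let E := Euclid d.

(** The identity of M, as a linear map in each direction between the given norm
    and the Euclidean norm: [lfun_bounded] applied to both gives the equivalence
    of the two norms. *)
Definition to_euclid : 'Hom(M, euclid_space E) :=
  linfun (fun x : M => x : euclid_space E).
Definition of_euclid : 'Hom(euclid_space E, M) :=
  linfun (fun x : euclid_space E => x : M).

Lemma to_euclidE x : to_euclid x = x.
Proof.
pose F : {linear M -> euclid_space E} := HB.pack (fun x : M => x : euclid_space E)
  (GRing.isLinear.Build R M (euclid_space E) *:%R
    (fun x : M => x : euclid_space E) (fun _ _ _ => erefl)).
exact: (lfunE F).
Qed.

Lemma of_euclidE x : of_euclid x = x.
Proof.
pose F : {linear euclid_space E -> M} := HB.pack (fun x : euclid_space E => x : M)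
  (GRing.isLinear.Build R (euclid_space E) M *:%R
    (fun x : euclid_space E => x : M) (fun _ _ _ => erefl)).
exact: (lfunE F).
Qed.

(** The topology of [E] comes from its scalar product, not from the norm of M:
    continuity of [of_euclid] gives that the ball is closed and is a neighbourhood
    of 0, and the bound on [to_euclid] gives that it is bounded. *)
Lemma unit_ball_body : sym_convex_body E (unit_ball M).
Proof.
split; last first.
  apply/seteqP; split => [_ [x x1 <-]|x x1]; first by rewrite /unit_ball /= normrN.
  by exists (- x); rewrite ?opprK// /unit_ball /= normrN.
split.
- have [C C0 hC] := lfun_bounded to_euclid.
  apply: (@bounded_closed_compact_vect _ (euclid_space E) _ C) => [x x1|].
    by have := hC x; rewrite to_euclidE => /le_trans; apply; rewrite ler_piMr.
  rewrite (_ : unit_ball M = (Num.norm \o of_euclid) @^-1` [set r | r <= 1]).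
    apply: preimage_closed; last exact: closed_le.
    move=> x _; apply: continuous_comp; first exact: lfun_continuous.
    exact: norm_continuous.
  by apply/seteqP; split => x; rewrite /unit_ball /= of_euclidE.
- apply/convex_setP => x y t x1 y1 t0 t1; rewrite /unit_ball /=.
  apply: le_trans (ler_normD _ _) _; rewrite !normrZ !ger0_norm ?subr_ge0//.
  rewrite (@le_trans _ _ (t * 1 + (1 - t) * 1))//; last by rewrite !mulr1 subrKC.
  by rewrite lerD// ler_wpM2l ?subr_ge0.
- exists (0 : euclid_space E).
  have : nbhs (0 : euclid_space E) (of_euclid @^-1` ball 0 1).
    apply: (@lfun_continuous _ _ _ of_euclid 0); rewrite linear0.
    exact: nbhsx_ballx.
  apply: filterS => x; rewrite /= -ball_normE /= sub0r normrN of_euclidE.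
  exact: ltW.
Qed.

End unit_ball_body.

(** * Symmetric convex bodies and their gauges *)

Section body.
Variables (R : realType) (E : euclid R) (P : set E).
Hypothesis bodyP : sym_convex_body E P.

Lemma bodyN x : P x -> P (- x).
Proof. by move=> Px; case: bodyP => _ <-; exists x. Qed.

Lemma body_convex x y (t : R) :
  P x -> P y -> 0 <= t -> t <= 1 -> P (t *: x + (1 - t) *: y).
Proof. by case: bodyP => -[_ /convex_setP cP _] _; exact: cP. Qed.

(** If the ball of radius [e] around [p] lies in P, then for |x| < e / 2 the point
    x is the midpoint of p + 2 x and - p, both of which are in P. *)
Lemma body_near0 : exists2 e : R, 0 < e & forall x, euclid_norm E x < e -> P x.
Proof.
have [p /nbhs_ballP[e /= e0 pe]] : exists p : E, nbhs (p : euclid_space E) P.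
  by case: (bodyP) => -[_ _ [p pP]] _; exists p.
exists (e / 2) => [|x xe]; first exact: divr_gt0.
have half : 1 - 2^-1 = 2^-1 :> R by lra.
have -> : x = 2^-1 *: (p + 2 *: x) + (1 - 2^-1) *: (- p).
  rewrite half scalerN -scalerBr addrAC subrr add0r scalerA mulVf// scale1r.
  by [].
have Pp : P p by apply: pe; exact: ballxx.
apply: body_convex; [|exact: bodyN|lra|lra].
apply: pe; rewrite -ball_normE /= opprD addNKr normrN.
by rewrite [ltLHS]euclid_normZ gtr0_norm//; lra.
Qed.

Lemma body0 : P 0.
Proof.
have [e e0] := body_near0; apply.
by rewrite -(scale0r 0) euclid_normZ normr0 mul0r.
Qed.

Lemma body_shrink x (t : R) : P x -> 0 <= t -> t <= 1 -> P (t *: x).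
Proof.
move=> Px t0 t1; rewrite -[_ *: _]addr0 -(@scaler0 _ E (1 - t)).
by apply: body_convex => //; exact: body0.
Qed.

Lemma body_bounded :
  exists2 C : R, 0 < C & forall x, P x -> euclid_norm E x < C.
Proof.
case: (bodyP) => -[cP _ _] _.
exact: (ex_strict_bound_gt0 (compact_bounded cP)).
Qed.

Lemma body_absorbing x : exists2 l : R, 0 < l & P (l^-1 *: x).
Proof.
have [e e0 eP] := body_near0; set n := euclid_norm E x.
have n0 : 0 <= n by exact: sqrtr_ge0.
exists ((n + 1) / e); first by rewrite divr_gt0 ?ltr_wpDl.
apply: eP; rewrite euclid_normZ -/n ger0_norm ?invr_ge0 ?divr_ge0 ?ltW ?ltr_wpDl//.
by rewrite invf_div mulrAC ltr_pdivrMr ?ltr_wpDl// ltr_pM2l// ltrDl.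
Qed.

Let gauge_lbound x : has_lbound [set l : R | 0 < l /\ P (l^-1 *: x)].
Proof. by exists 0 => l [/ltW]. Qed.

Let gauge_nonempty x : [set l : R | 0 < l /\ P (l^-1 *: x)] !=set0.
Proof. by have [l l0 lP] := body_absorbing x; exists l. Qed.

Lemma gauge_le x (l : R) : 0 < l -> P (l^-1 *: x) -> gauge P x <= l.
Proof. by move=> l0 lP; exact: ge_inf. Qed.

Lemma le_gauge x (m : R) :
  (forall l, 0 < l -> P (l^-1 *: x) -> m <= l) -> m <= gauge P x.
Proof. by move=> h; apply: lb_le_inf => // l [l0 lP]; exact: h. Qed.

Lemma gauge_ge0 x : 0 <= gauge P x.
Proof. by apply: le_gauge => l /ltW. Qed.

(** P is star-shaped at 0, so any scale above the infimum is admissible. *)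
Lemma gauge_lt x (l : R) : gauge P x < l -> P (l^-1 *: x).
Proof.
move=> /(inf_lt (gauge_nonempty x))[k [k0 kP] kl].
have l0 := lt_trans k0 kl.
have -> : l^-1 *: x = (k / l) *: (k^-1 *: x).
  by rewrite scalerA mulrAC mulfV ?gt_eqF// mul1r.
apply: body_shrink => //; first by rewrite divr_ge0 ?ltW.
by rewrite ler_pdivrMr// mul1r ltW.
Qed.

End body.

(** The common form of homogeneity of the gauge and of the mapping property of the
    tensor norm. *)
Lemma gauge_le_scale (R : realType) (E F : euclid R) (P : set E) (Q : set F)
    (c : R) (x : E) (y : F) :
  sym_convex_body E P -> 0 < c ->
  (forall l, 0 < l -> P (l^-1 *: x) -> Q ((c * l)^-1 *: y)) ->
  gauge Q y <= c * gauge P x.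
Proof.
move=> bP c0 h; rewrite -ler_pdivrMl//; apply: le_gauge => // l l0 lP.
by rewrite ler_pdivrMl//; apply: gauge_le; rewrite ?mulr_gt0//; exact: h.
Qed.

Lemma gauge_norm (R : realType) (E : euclid R) (P : set E) :
  sym_convex_body E P -> is_norm (gauge P).
Proof.
move=> bP; split.
- move=> x gx; apply/eqP; apply: contra_eqT gx => x0.
  have n0 : 0 < euclid_norm E x by rewrite sqrtr_gt0 dot_gt0.
  have [C C0 PC] := body_bounded bP.
  rewrite gt_eqF//; apply: (@lt_le_trans _ _ (euclid_norm E x / C)).
    exact: divr_gt0.
  apply: le_gauge => // l l0 /PC; rewrite euclid_normZ gtr0_norm ?invr_gt0//.
  by rewrite mulrC ltr_pdivrMr// ler_pdivrMr// mulrC => /ltW.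
- move=> x y; apply/ler_addgt0Pr => e e0.
  pose l := gauge P x + e / 2; pose m := gauge P y + e / 2.
  have e2 : 0 < e / 2 by rewrite divr_gt0.
  have l0 : 0 < l by rewrite ltr_wpDl// gauge_ge0.
  have m0 : 0 < m by rewrite ltr_wpDl// gauge_ge0.
  rewrite (_ : _ + e = l + m); last by rewrite /l /m; lra.
  have lm0 : 0 < l + m by rewrite addr_gt0.
  apply: gauge_le => //.
  (* x + y rescaled is the average of x / l and y / m with weights l and m *)
  have -> : (l + m)^-1 *: (x + y) =
      (l / (l + m)) *: (l^-1 *: x) + (1 - l / (l + m)) *: (m^-1 *: y).
    rewrite scalerDr !scalerA; congr (_ *: _ + _ *: _); field; by rewrite !gt_eqF.
  apply: body_convex => //; [| |by rewrite divr_ge0 ?ltW|].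
  + by apply: gauge_lt; rewrite // ltrDl.
  + by apply: gauge_lt; rewrite // ltrDl.
  + by rewrite ler_pdivrMr// mul1r lerDl ltW.
- have le_homog (a : R) x : a != 0 -> gauge P (a *: x) <= `|a| * gauge P x.
    move=> a0; have a0' : 0 < `|a| by rewrite normr_gt0.
    apply: gauge_le_scale => // l l0 lP.
    have [al|al] :
        (`|a| * l)^-1 * a = l^-1 :> R \/ (`|a| * l)^-1 * a = - l^-1 :> R.
      have l0' : l != 0 by rewrite gt_eqF.
      by have [a1|a1] := ltrP 0 a;
        [left; rewrite gtr0_norm//|right; rewrite ler0_norm//];
        field; rewrite l0' a0.
    - by rewrite scalerA al.
    - by rewrite scalerA al scaleNr; exact: bodyN.
  move=> a x; have [->|a0] := eqVneq a 0.
    rewrite scale0r normr0 mul0r; apply/eqP; rewrite eq_le gauge_ge0// andbT.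
    apply/ler_addgt0Pr => e e0; rewrite add0r; apply: gauge_le => //.
    by rewrite scaler0; exact: body0.
  apply/eqP; rewrite eq_le le_homog//= -ler_pdivlMl ?normr_gt0// -normfV.
  by rewrite -{1}[x](scalerK a0) le_homog// invr_eq0.
Qed.

(** * Polars and separation *)

Lemma polarE (R : realType) (E : euclid R) (P : set E) v :
  polar E P v <-> forall x, P x -> dot E x v <= 1.
Proof.
split=> [/ereal_supP h x Px|h].
  by rewrite -lee_fin; apply: h; exists x.
by apply/ereal_supP => _ [x Px <-]; rewrite lee_fin; exact: h.
Qed.

(** Let p be the point of P nearest to y and w = y - p.  The half-space
    {b | <b, w> <= <p, w>} contains P and, since <w, w> > 0, not y; as <p, w> > 0,
    the vector w / <p, w> is in the polar of P. *)
Lemma polar_separation (R : realType) (E : euclid R) (P : set E) y :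
  sym_convex_body E P -> ~ P y -> exists2 v, polar E P v & 1 < dot E y v.
Proof.
move=> bP Py.
have fc : continuous (fun b : euclid_space E => `|(y : euclid_space E) - b|).
  move=> b; apply: (@continuous_comp _ _ _ (fun b : euclid_space E =>
    (y : euclid_space E) - b) Num.norm); last exact: norm_continuous.
  by apply: continuousB => //; exact: cst_continuous.
have [cP _ _] := bP.1.
have [p /set_mem Pp pmin] := compact_EVT_min (ex_intro _ 0 (body0 bP)) cP
  (continuous_subspaceT fc).
pose w : E := y - p.
have sqD (a : R) (c : E) :
    dot E (w + a *: c) (w + a *: c) =
    dot E w w + 2 * a * dot E c w + a ^+ 2 * dot E c c.
  by move: w => w; rewrite dotDl !dotDr !dotZl !dotZr [dot E w c]dotC; ring.
have w0 : 0 < dot E w w.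
  by apply: dot_gt0; rewrite subr_eq0; apply: contra_notN Py => /eqP ->.
have wmin b : P b -> dot E w w <= dot E (y - b) (y - b).
  move=> Pb; rewrite -(@ler_sqrt _ _ (dot E (y - b) _)) ?dot_ge0//.
  exact: (pmin b (mem_set Pb)).
have wP b : P b -> dot E b w <= dot E p w.
  move=> Pb; rewrite leNgt; apply/negP => bp.
  (* otherwise a small step t from p towards b gets closer to y: the square of
     the distance changes by - 2 t s + t^2 q, negative for t = s / (s + q) *)
  pose s := dot E b w - dot E p w; pose q := dot E (b - p) (b - p).
  have s0 : 0 < s by rewrite subr_gt0.
  have q0 : 0 <= q by exact: dot_ge0.
  have sq0 : 0 < s + q by rewrite ltr_wpDr.
  pose t := s / (s + q).
  have t0 : 0 < t by exact: divr_gt0.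
  have ts : t * (s + q) = s by rewrite divfK// gt_eqF.
  have t1 : t <= 1 by rewrite ler_pdivrMr// mul1r lerDl.
  have := wmin _ (body_convex bP Pb Pp (ltW t0) t1).
  have -> : y - (t *: b + (1 - t) *: p) = w + (- t) *: (b - p).
    by rewrite /w scalerBl scale1r !scaleNr scalerBr [_ + (p - _)]addrCA opprD addrA.
  have cw : dot E (b - p) w = s by rewrite dotDl -scaleN1r dotZl mulN1r.
  rewrite sqD cw -/q.
  have ts0 : 0 < t * s by exact: mulr_gt0.
  have tts0 : 0 < t * (t * s) by exact: mulr_gt0.
  have -> : (- t) ^+ 2 * q = t * s - t * (t * s).
    by rewrite -mulrBr -[in X in X - _]ts; ring.
  move: (dot E w w) => W; lra.
(* a small positive multiple of w lies in P, by which <p, w> > 0 *)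
have [l l0 lw] := body_absorbing bP w.
have s0 : 0 < dot E p w.
  by apply: lt_le_trans (wP _ lw); rewrite dotZl mulr_gt0// invr_gt0.
exists ((dot E p w)^-1 *: w).
  by apply/polarE => b Pb; rewrite dotZr ler_pdivrMl// mulr1 wP.
rewrite dotZr ltr_pdivlMl// mulr1 -[y](subrK p) -/w dotDl.
by rewrite ltrDr.
Qed.

(** The hard half of the duality between a norm and the polar of its unit ball,
    with the functionals of norm at most 1 represented by vectors. *)
Lemma lt_norm_polar (R : realType) (M : normedVectType R)
    (d : {dot M for idfun}) (x : M) (r : R) :
  0 < r -> r < `|x| ->
  exists2 u, polar (Euclid d) (unit_ball M) u & r < dot (Euclid d) x u.
Proof.
move=> r0 rx.
have [|u pu] := @polar_separation _ (Euclid d) _ (r^-1 *: x) (unit_ball_body d).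
  rewrite /unit_ball /= normrZ gtr0_norm ?invr_gt0// ler_pdivrMl// mulr1.
  by apply/negP; rewrite -ltNge.
by rewrite dotZl ltr_pdivlMl// mulr1; exists u.
Qed.

(** * Tensors and linear maps *)

Section pure.
Variables (R : realType) (V W : vectType R).

Lemma pureZ (a b : R) (x : V) (y : W) :
  pure (a *: x) (b *: y) = (a * b) *: pure x y.
Proof. by apply/matrixP => i j; rewrite !mxE /basis_coord !linearZ /= mulrACA. Qed.

Lemma pure0l (y : W) : pure (0 : V) y = 0.
Proof. by rewrite -[0 : V](scale0r 0) -[y]scale1r pureZ mul0r scale0r. Qed.

Lemma pure0r (x : V) : pure x (0 : W) = 0.
Proof. by rewrite -[0 : W](scale0r 0) -[x]scale1r pureZ mulr0 scale0r. Qed.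

End pure.

Section tensor_map.
Variables (R : realType) (V V' W W' : vectType R).
Variables (S : 'Hom(V, V')) (T : 'Hom(W, W')).

HB.instance Definition _ := GRing.isLinear.Build R (tensor V W) (tensor V' W')
  *:%R (tensor_map S T) (tensor_map_linear S T).

Lemma tensor_mapZ (a b : R) z :
  tensor_map (a *: S) (b *: T) z = (a * b) *: tensor_map S T z.
Proof.
rewrite /tensor_map scaler_sumr; apply: eq_bigr => i _.
rewrite scaler_sumr; apply: eq_bigr => j _.
by rewrite !scale_lfunE pureZ !scalerA mulrC.
Qed.

Lemma tensor_map0l z : tensor_map (0 : 'Hom(V, V')) T z = 0.
Proof.
rewrite /tensor_map big1// => i _; rewrite big1// => j _.
by rewrite zero_lfunE pure0l scaler0.
Qed.

Lemma tensor_map0r z : tensor_map S (0 : 'Hom(W, W')) z = 0.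
Proof.
rewrite /tensor_map big1// => i _; rewrite big1// => j _.
by rewrite zero_lfunE pure0r scaler0.
Qed.

End tensor_map.

Section lfun_tensor.
Variables (R : realType) (M N : normedVectType R).

Lemma lfun_tensor_is_linear : linear (@lfun_tensor R M N).
Proof.
move=> a S T; rewrite /lfun_tensor scaler_sumr -big_split; apply: eq_bigr => i _ /=.
by rewrite add_lfunE scale_lfunE pureDr.
Qed.

HB.instance Definition _ := GRing.isLinear.Build R 'Hom(M, N)
  (tensor (dual M) N) *:%R (@lfun_tensor R M N) lfun_tensor_is_linear.

(** The contraction f (x) y |-> f(.) y, the inverse of T |-> u_T. *)
Definition tensor_lfun (z : tensor (dual M) N) : 'Hom(M, N) :=
  \sum_i \sum_j z i j *: rank_one (basis_vec i : dual M) (basis_vec j).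

Lemma tensor_lfunD z w : tensor_lfun (z + w) = tensor_lfun z + tensor_lfun w.
Proof.
rewrite /tensor_lfun -big_split; apply: eq_bigr => i _ /=.
by rewrite -big_split; apply: eq_bigr => j _ /=; rewrite mxE scalerDl.
Qed.

Lemma tensor_lfun0 : tensor_lfun 0 = 0.
Proof.
by rewrite /tensor_lfun big1// => i _; rewrite big1// => j _; rewrite mxE scale0r.
Qed.

Lemma tensor_lfun_pure (f : dual M) (y : N) :
  tensor_lfun (pure f y) = rank_one f y.
Proof.
apply/lfunP => x; rewrite rank_oneE sum_lfunE.
have -> : (f x : R) = \sum_i basis_coord i f * ((basis_vec i : dual M) x : R).
  rewrite {1}(basis_coordE f) (@sum_lfunE _ _ _ _ _ _
    (fun i => basis_coord i f *: (basis_vec i : dual M) : 'Hom(M, R^o))).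
  by apply: eq_bigr => i _; rewrite scale_lfunE.
rewrite scaler_suml; apply: eq_bigr => i _; rewrite sum_lfunE.
rewrite {2}(basis_coordE y) scaler_sumr; apply: eq_bigr => j _.
by rewrite scale_lfunE rank_oneE !scalerA mxE mulrAC.
Qed.

Lemma lfun_tensorK : cancel (@lfun_tensor R M N) tensor_lfun.
Proof.
move=> T; rewrite [RHS]lfun_rank_one /lfun_tensor.
rewrite (big_morph tensor_lfun tensor_lfunD tensor_lfun0).
by apply: eq_bigr => i _; rewrite tensor_lfun_pure.
Qed.

End lfun_tensor.

Lemma lfun_tensor1 (R : realType) (M N : normedVectType R) (f : dual M) (y : N) :
  lfun_tensor (rank_one f y) = pure f y.
Proof.
by have := lfun_tensor_rank_one (fun _ : 'I_1 => f) (fun=> y); rewrite !big_ord1.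
Qed.

Section adjoint.
Variables (R : realType) (M M0 : normedVectType R) (T : 'Hom(M, M0)).

Definition adjoint : 'Hom(dual M0, dual M) :=
  linfun (fun f : dual M0 => (dual_fun f \o T)%VF : dual M).

Lemma adjointE (f : dual M0) : adjoint f = (dual_fun f \o T)%VF.
Proof.
have h : linear (fun f : dual M0 => (dual_fun f \o T)%VF : dual M).
  move=> a u v; apply/lfunP => x.
  by rewrite !(add_lfunE, scale_lfunE, comp_lfunE).
pose F : {linear dual M0 -> dual M} := HB.pack
  (fun f : dual M0 => (dual_fun f \o T)%VF : dual M)
  (GRing.isLinear.Build R (dual M0) (dual M) *:%R _ h).
exact: (lfunE F).
Qed.

Lemma opnorm_adjoint : opnorm adjoint <= opnorm T.
Proof.
apply: opnorm_le => f f1; rewrite adjointE; apply: opnorm_le => x x1.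
rewrite comp_lfunE; apply: le_trans (le_opnorm _ _) _.
rewrite -[leRHS]mul1r ler_pM ?opnorm_ge0//.
exact: opnorm_ge.
Qed.

End adjoint.

(** U (f(.) y) T = (T^* f)(.) (U y), so both sides agree on the rank one terms of
    S. *)
Lemma lfun_tensor_comp (R : realType) (M M0 N0 N : normedVectType R)
    (T : 'Hom(M, M0)) (S : 'Hom(M0, N0)) (U : 'Hom(N0, N)) :
  lfun_tensor (U \o S \o T)%VF = tensor_map (adjoint T) U (lfun_tensor S).
Proof.
have -> : (U \o S \o T)%VF = \sum_i rank_one
    (adjoint T (linfun (basis_coord i : M0 -> R^o) : dual M0))
    (U (S (basis_vec i))).
  apply/lfunP => x; rewrite sum_lfunE !comp_lfunE {1}(basis_coordE (T x)).
  rewrite !linear_sum; apply: eq_bigr => i _.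
  by rewrite !linearZ rank_oneE adjointE comp_lfunE linfun_coordE.
rewrite lfun_tensor_rank_one /lfun_tensor linear_sum.
by apply: eq_bigr => i _ /=; rewrite tensor_map_pure.
Qed.

(** * The tensor norm *)

Section tensor_norm.
Variables (R : realType) (alpha : body_operation R).
Hypothesis alphaP : is_tensor_product alpha.

Lemma alpha_ball_body (M1 M2 : normedVectType R)
    (d1 : {dot M1 for idfun}) (d2 : {dot M2 for idfun}) :
  sym_convex_body (tensor_euclid (Euclid d1) (Euclid d2))
    (@alpha (Euclid d1) (Euclid d2) (unit_ball M1) (unit_ball M2)).
Proof. by apply: tensor_body => //; exact: unit_ball_body. Qed.

Lemma tensor_norm_is_norm (M1 M2 : normedVectType R)
    (d1 : {dot M1 for idfun}) (d2 : {dot M2 for idfun}) :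
  is_norm (tensor_norm alpha d1 d2).
Proof. exact: gauge_norm (alpha_ball_body d1 d2). Qed.

Lemma tensor_norm0 (M1 M2 : normedVectType R)
    (d1 : {dot M1 for idfun}) (d2 : {dot M2 for idfun}) :
  tensor_norm alpha d1 d2 0 = 0.
Proof.
have [_ _ hZ] := tensor_norm_is_norm d1 d2.
by rewrite -[0 in LHS](scale0r 0) hZ normr0 mul0r.
Qed.

(** Uniformity needs maps sending unit balls into unit balls, hence the division
    by the operator norms; a map of norm 0 is 0 and is treated apart. *)
Lemma tensor_norm_map (M1 M2 N1 N2 : normedVectType R)
    (d1 : {dot M1 for idfun}) (d2 : {dot M2 for idfun})
    (e1 : {dot N1 for idfun}) (e2 : {dot N2 for idfun})
    (T1 : 'Hom(M1, N1)) (T2 : 'Hom(M2, N2)) (z : tensor M1 M2) :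
  tensor_norm alpha e1 e2 (tensor_map T1 T2 z) <=
    opnorm T1 * opnorm T2 * tensor_norm alpha d1 d2 z.
Proof.
have [/opnorm0_eq0 ->|n1] := eqVneq (opnorm T1) 0.
  rewrite tensor_map0l tensor_norm0 !mulr_ge0 ?opnorm_ge0//.
  exact: gauge_ge0 (alpha_ball_body d1 d2) _.
have [/opnorm0_eq0 ->|n2] := eqVneq (opnorm T2) 0.
  rewrite tensor_map0r tensor_norm0 !mulr_ge0 ?opnorm_ge0//.
  exact: gauge_ge0 (alpha_ball_body d1 d2) _.
have normalize (V W : normedVectType R) (T : 'Hom(V, W)) : opnorm T != 0 ->
    ((opnorm T)^-1 *: T) @` unit_ball V `<=` unit_ball W.
  move=> n0 _ [x x1 <-]; have n0' : 0 < opnorm T by rewrite lt_def n0 opnorm_ge0.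
  rewrite /unit_ball /= scale_lfunE normrZ gtr0_norm ?invr_gt0//.
  by rewrite ler_pdivrMl// mulr1 opnorm_ge.
apply: gauge_le_scale; first exact: alpha_ball_body.
  by rewrite mulr_gt0// lt_def opnorm_ge0 ?n1 ?n2.
move=> l l0 lz.
apply: (@tensor_uniform _ _ alphaP
  (Euclid d1) (Euclid d2) (Euclid e1) (Euclid e2)
  (unit_ball M1) (unit_ball M2) (unit_ball N1) (unit_ball N2)
  ((opnorm T1)^-1 *: T1) ((opnorm T2)^-1 *: T2));
  [exact: unit_ball_body|exact: unit_ball_body|exact: unit_ball_body|
   exact: unit_ball_body|exact: normalize|exact: normalize|].
exists (l^-1 *: z) => //.
by rewrite tensor_mapZ linearZ /= scalerA !invfM.
Qed.

(** If the norm of x (x) y were below some l < |x| |y|, then x (x) y / l would be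
    in the injective product.  Split l = (l / s) s with l / s < |x| and s < |y|,
    and take u, v in the polars with <x, u> > l / s and <y, v> > s: then
    <x (x) y / l, u (x) v> > 1, a contradiction. *)
Lemma tensor_norm_pure (M1 M2 : normedVectType R)
    (d1 : {dot M1 for idfun}) (d2 : {dot M2 for idfun}) (x : M1) (y : M2) :
  tensor_norm alpha d1 d2 (pure x y) = `|x| * `|y|.
Proof.
have [->|x0] := eqVneq x 0; first by rewrite pure0l tensor_norm0 normr0 mul0r.
have [->|y0] := eqVneq y 0; first by rewrite pure0r tensor_norm0 normr0 mulr0.
have nx : 0 < `|x| by rewrite normr_gt0.
have ny : 0 < `|y| by rewrite normr_gt0.
have b1 := unit_ball_body d1; have b2 := unit_ball_body d2.
have bA := alpha_ball_body d1 d2.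
apply/eqP; rewrite eq_le; apply/andP; split.
  apply: gauge_le; first exact: mulr_gt0.
  apply: (tensor_ge_proj alphaP b1 b2).
  exists 1%N, (fun=> 1), (fun=> (`|x| * `|y|)^-1 *: pure x y); split.
  - by move=> _; exact: ler01.
  - by rewrite big_ord1.
  - move=> _; rewrite invfM -pureZ.
    have unit (V : normedVectType R) (v : V) : 0 < `|v| ->
        unit_ball V (`|v|^-1 *: v).
      by move=> v0; rewrite /unit_ball /= normrZ normfV normr_id mulVf// gt_eqF.
    by exists (`|x|^-1 *: x); [exact: unit|exists (`|y|^-1 *: y) => //; exact: unit].
  - by rewrite big_ord1 scale1r.
rewrite leNgt; apply/negP => gxy.
pose g := tensor_norm alpha d1 d2 (pure x y).
have g0 : 0 <= g by exact: gauge_ge0 bA _.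
have [l gl lxy] : exists2 l, g < l & l < `|x| * `|y|.
  by exists ((g + `|x| * `|y|) / 2); rewrite ?midf_lt.
have l0 : 0 < l by exact: le_lt_trans gl.
have [s ls sy] : exists2 s, l / `|x| < s & s < `|y|.
  by exists ((l / `|x| + `|y|) / 2); rewrite ?midf_lt// ltr_pdivrMr// mulrC.
have s0 : 0 < s by apply: lt_trans ls; exact: divr_gt0.
have [u pu us] : exists2 u, polar (Euclid d1) (unit_ball M1) u &
    l / s < dot (Euclid d1) x u.
  by apply: lt_norm_polar; rewrite ?divr_gt0// ltr_pdivrMr// mulrC -ltr_pdivrMr.
have [v pv vs] := lt_norm_polar d2 s0 sy.
have /(tensor_le_inj alphaP b1 b2)/polarE/(_ (pure u v)) := gauge_lt bA gl.
rewrite dotZr.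
have -> : dot (tensor_euclid (Euclid d1) (Euclid d2)) (pure u v) (pure x y) =
    dot (Euclid d1) x u * dot (Euclid d2) y v.
  by rewrite [LHS]dotC; exact: tensor_dot_pure.
rewrite ler_pdivrMl// mulr1 leNgt => /(_ _)/negP; apply.
  exists 1%N, (fun=> 1), (fun=> pure u v); split.
  - by move=> _; exact: ler01.
  - by rewrite big_ord1.
  - by move=> _; exists u => //; exists v.
  - by rewrite big_ord1 scale1r.
rewrite -[ltLHS](@divfK _ s) ?gt_eqF//.
by apply: ltr_pM => //; rewrite ltW// divr_gt0.
Qed.

End tensor_norm.

Theorem corollary4p1 (R : realType) (alpha : body_operation R)
  (alphaP : is_tensor_product alpha)
  (d1 : forall M1 M2 : normedVectType R, {dot M1 for idfun})
  (d2 : forall M1 M2 : normedVectType R, {dot M2 for idfun}) :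
  is_ideal_norm (fun (M N : normedVectType R) (T : 'Hom(M, N)) =>
    tensor_norm alpha (d1 (dual M) N) (d2 (dual M) N) (lfun_tensor T)).
Proof.
split.
- move=> M N.
  have [n0 nD nZ] := tensor_norm_is_norm alphaP (d1 (dual M) N) (d2 (dual M) N).
  split => [T /n0 T0|S T|a T].
  + by rewrite -[T]lfun_tensorK T0 tensor_lfun0.
  + by rewrite linearD; exact: nD.
  + by rewrite linearZ; exact: nZ.
- by move=> M N f y; rewrite lfun_tensor1 tensor_norm_pure.
- move=> M M0 N0 N T S U; rewrite lfun_tensor_comp.
  apply: le_trans (tensor_norm_map alphaP
    (d1 (dual M0) N0) (d2 (dual M0) N0) _ _ _ _ _) _.
  rewrite -mulrA mulrC ler_wpM2l ?opnorm_adjoint// mulr_ge0 ?opnorm_ge0//.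
  exact: gauge_ge0 (alpha_ball_body alphaP _ _) _.
Qed.
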